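(* For every integer $m \ge 3$, we have $\chi'_{st}(C_m \,\square\, P_2) = 6$ if $m = 3$; $\chi'_{st}(C_m \,\square\, P_2) = 4$ if $m \equiv 0 \pmod 4$; and $\chi'_{st}(C_m \,\square\, P_2) = 5$ otherwise.
   Context: A star edge-coloring of a graph $G$ is a proper edge-coloring of $G$ in which there is no bichromatic path and no bichromatic cycle of length four (i.e., with four edges). The star chromatic index $\chi'_{st}(G)$ is the minimum number of colors in a star edge-coloring of $G$. $C_m$ denotes the cycle on $m$ vertices and $P_n$ the path on $n$ vertices. $G \,\square\, H$ denotes the Cartesian product: vertex set $V(G)\times V(H)$, with $(u,v)(u',v')$ an edge iff either $uu'\in E(G)$ and $v=v'$, or $u=u'$ and $vv'\in E(H)$. *)

(* Defs.v *)
From HB Require Import structures.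
From mathcomp Require Import all_boot.

Set Implicit Arguments.
Unset Strict Implicit.
Unset Printing Implicit Defensive.

Record sgraph := SGraph {
  vertex :> finType;
  adj : rel vertex;
  adj_sym : symmetric adj;
  adj_irrefl : irreflexive adj }.

Definition edge_set (G : sgraph) : {set {set G}} :=
  [set e | [exists x : G, exists y : G, adj x y && (e == [set x; y])]].

Definition edge (G : sgraph) : finType := {e : {set G} | e \in edge_set G}.

Definition steps (G : sgraph) (x : G) (s : seq G) : seq {set G} :=
  pairmap (fun y z => [set y; z]) x s.

(* t lists, in order, the edges of a path of G with four edges *)
Definition is_path4 (G : sgraph) (t : 4.-tuple (edge G)) : bool :=
  [exists x : G, exists s : 4.-tuple G,
    uniq (x :: s) && (map val t == steps x s)].

(* t lists, in order, the edges of a cycle of G with four edges *)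
Definition is_cycle4 (G : sgraph) (t : 4.-tuple (edge G)) : bool :=
  [exists x : G, exists s : 3.-tuple G,
    uniq (x :: s) && (map val t == steps x (rcons s x))].

Definition proper_edge_coloring (G : sgraph) (k : nat)
    (c : {ffun edge G -> 'I_k}) : bool :=
  [forall e : edge G, forall f : edge G,
    (e != f) && ~~ [disjoint val e & val f] ==> (c e != c f)].

Definition bichromatic (G : sgraph) (k : nat) (c : {ffun edge G -> 'I_k})
    (t : 4.-tuple (edge G)) : bool :=
  size (undup (map c t)) == 2.

Definition star_edge_coloring (G : sgraph) (k : nat)
    (c : {ffun edge G -> 'I_k}) : bool :=
  proper_edge_coloring c &&
  [forall t : 4.-tuple (edge G),
    is_path4 t || is_cycle4 t ==> ~~ bichromatic c t].

Definition star_edge_colorable (G : sgraph) (k : nat) : bool :=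
  [exists c : {ffun edge G -> 'I_k}, star_edge_coloring c].

Lemma uniq_path4_or_cycle4 (G : sgraph) (t : 4.-tuple (edge G)) :
  is_path4 t || is_cycle4 t -> uniq t.
Proof.
have neqC (a b : G) : a != b -> ((a == b) = false) * ((b == a) = false).
  by move=> ab; rewrite [b == a]eq_sym (negPf ab).
have set2N (a b x y : G) : [set a; b] == [set x; y] ->
    [&& (a == x) || (a == y), (b == x) || (b == y),
        (x == a) || (x == b) & (y == a) || (y == b)].
  move/eqP/setP=> H; move: (H a) (H b) (H x) (H y).
  by rewrite !inE !eqxx !orbT /= => <- <- -> ->.
rewrite -(map_inj_uniq val_inj).
case/orP=> /existsP[x /existsP[[s /= /eqP sz_s] /andP[Us /eqP->]]].
  case: s sz_s Us => [|a [|b [|c [|d [|? ?]]]]] //= _.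
  rewrite !inE !negb_or -!andbA.
  case/and5P=> /neqC xa /neqC xb /neqC xc /neqC xd.
  case/and5P=> /neqC ab /neqC ac /neqC ad /neqC bc /and3P[/neqC bd /neqC cd _].
  by do ?[apply/andP; split] => //; apply/negP=> /set2N;
     rewrite ?xa ?xb ?xc ?xd ?ab ?ac ?ad ?bc ?bd ?cd ?andbF.
case: s sz_s Us => [|a [|b [|c [|? ?]]]] //= _.
rewrite !inE !negb_or -!andbA.
case/and5P=> /neqC xa /neqC xb /neqC xc /neqC ab /and3P[/neqC ac /neqC bc _].
by do ?[apply/andP; split] => //; apply/negP=> /set2N;
   rewrite ?xa ?xb ?xc ?ab ?ac ?bc ?andbF.
Qed.

Lemma ex_star_edge_colorable (G : sgraph) : exists k, star_edge_colorable G k.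
Proof.
exists #|edge G|; apply/existsP; exists [ffun e => enum_rank e].
have inj_c : injective [ffun e : edge G => enum_rank e].
  by move=> e f; rewrite !ffunE; apply: enum_rank_inj.
apply/andP; split.
  apply/forallP=> e; apply/forallP=> f; apply/implyP=> /andP[ne_ef _].
  by rewrite (inj_eq inj_c).
apply/forallP=> t; apply/implyP=> /uniq_path4_or_cycle4 Ut.
by rewrite /bichromatic undup_id ?map_inj_uniq // size_map size_tuple.
Qed.

Definition star_chromatic_index (G : sgraph) : nat :=
  ex_minn (ex_star_edge_colorable G).

(* The cycle on m vertices, meant for m >= 3; the condition i != j only
   excludes the loop that would otherwise appear when m = 1. *)
Definition cycle_adj (m : nat) (i j : 'I_m) : bool :=
  (i != j) && ((j == ordS i) || (i == ordS j)).

Lemma cycle_adj_sym (m : nat) : symmetric (@cycle_adj m).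
Proof. by move=> i j; rewrite /cycle_adj eq_sym orbC. Qed.

Lemma cycle_adj_irrefl (m : nat) : irreflexive (@cycle_adj m).
Proof. by move=> i; rewrite /cycle_adj eqxx. Qed.

Definition cycle_graph (m : nat) : sgraph :=
  SGraph (@cycle_adj_sym m) (@cycle_adj_irrefl m).

Definition path_adj (n : nat) (i j : 'I_n) : bool :=
  (val j == (val i).+1) || (val i == (val j).+1).

Lemma path_adj_sym (n : nat) : symmetric (@path_adj n).
Proof. by move=> i j; rewrite /path_adj orbC. Qed.

Lemma path_adj_irrefl (n : nat) : irreflexive (@path_adj n).
Proof. by move=> i; rewrite /path_adj orbb ltn_eqF. Qed.

Definition path_graph (n : nat) : sgraph :=
  SGraph (@path_adj_sym n) (@path_adj_irrefl n).

Definition box_adj (G H : sgraph) (p q : G * H) : bool :=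
  (adj p.1 q.1 && (p.2 == q.2)) || ((p.1 == q.1) && adj p.2 q.2).

Lemma box_adj_sym (G H : sgraph) : symmetric (@box_adj G H).
Proof.
by move=> p q; rewrite /box_adj adj_sym [adj p.2 _]adj_sym
  [p.1 == _]eq_sym [p.2 == _]eq_sym.
Qed.

Lemma box_adj_irrefl (G H : sgraph) : irreflexive (@box_adj G H).
Proof. by move=> p; rewrite /box_adj !adj_irrefl andbF. Qed.

Definition box_product (G H : sgraph) : sgraph :=
  SGraph (@box_adj_sym G H) (@box_adj_irrefl G H).

(* Main.v *)
Require Import Defs.
From mathcomp Require Import all_boot zify.

(** A proper edge-coloring is a star edge-coloring iff no non-backtracking walk
with four edges is colored [abab]: such a walk is a path or a 4-cycle, because
if three consecutive edges formed a triangle, then two incident edges would share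
a color.  Non-backtracking walks of the prism lift to the
ladder, so the star edge-colorings of [C_m] x [P_2] are the [m]-periodic
colorings of the ladder in which every window of four columns is good.

Upper bounds come from gluing blocks of columns that start with the same three
columns.  For the lower bounds, exhaustive enumeration shows that two columns
cannot be colored with 3 colors, that in a 4-coloring of five columns the fifth
column repeats the first while the third differs from it (so that 4 divides
[m]), and that the triangular prism has no coloring with 5 colors. *)

Set Implicit Arguments.
Unset Strict Implicit.
Unset Printing Implicit Defensive.

(** * Star edge-colorings as symmetric weights on adjacent pairs of vertices *)

Definition star_edge_weight (G : sgraph) (k : nat) (g : G -> G -> nat) : Prop :=
  [/\ forall x y, adj x y -> g x y = g y x,
      forall x y, adj x y -> g x y < k,
      forall x y z, adj x y -> adj y z -> x != z -> g x y != g y z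
    & forall x0 x1 x2 x3 x4,
        adj x0 x1 -> adj x1 x2 -> adj x2 x3 -> adj x3 x4 ->
        x0 != x2 -> x1 != x3 -> x2 != x4 ->
        ~~ ((g x0 x1 == g x2 x3) && (g x1 x2 == g x3 x4))].

Section EdgeWeights.

Variable G : sgraph.
Implicit Types (x y z : G) (e f : edge G).

Lemma adj_neq x y : adj x y -> x != y.
Proof. by apply: contraTneq => ->; rewrite adj_irrefl. Qed.

Lemma edge_adj e x y : val e = [set x; y] -> adj x y.
Proof.
have := valP e; rewrite inE => /existsP[u /existsP[v /andP[uv /eqP->]]] E.
have uNv := adj_neq uv.
have /set2P[] : u \in [set x; y] by rewrite -E set21.
  move=> eu; subst u; suff <- : v = y by [].
  have /set2P[ev|//] : v \in [set x; y] by rewrite -E set22.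
  by rewrite ev eqxx in uNv.
move=> eu; subst u; suff <- : v = x by rewrite adj_sym.
have /set2P[//|ev] : v \in [set x; y] by rewrite -E set22.
by rewrite ev eqxx in uNv.
Qed.

Lemma adj_edge x y : adj x y -> exists e, val e = [set x; y].
Proof.
move=> xy; have P : [set x; y] \in edge_set G.
  by rewrite inE; apply/existsP; exists x; apply/existsP; exists y; rewrite xy /=.
by exists (exist (fun e : {set G} => e \in edge_set G) _ P).
Qed.

Lemma edge_end e z : z \in val e -> exists2 x, adj x z & val e = [set x; z].
Proof.
have := valP e; rewrite inE => /existsP[u /existsP[v /andP[uv /eqP->]]].
case/set2P=> ->; first by exists v; [rewrite adj_sym | rewrite setUC].
by exists u.
Qed.

(** Weights on ordered pairs let colors be read along walks without the subtype of edges.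
    Conversely, along four edges with consecutive colors distinct, exactly two colors can occur only
    in the pattern [abab]. *)
Lemma star_edge_colorableP k :
  reflect (exists g, @star_edge_weight G k g) (star_edge_colorable G k).
Proof.
apply: (iffP existsP) => [[c /andP[/'forall_forallP pc /forallP sc]]|[g [gS gk gP g4]]].
  (* The value 0 on non-edges is a dummy. *)
  pose g x y : nat := if insub [set x; y] is Some e then c e else 0.
  have gE e x y : val e = [set x; y] -> g x y = c e.
    by move=> E; rewrite /g -E valK.
  have gP x y z : adj x y -> adj y z -> x != z -> g x y != g y z.
    move=> /adj_edge[e Ee] /adj_edge[f Ef] xz.
    rewrite (gE _ _ _ Ee) (gE _ _ _ Ef).
    apply: (implyP (pc e f)); apply/andP; split.
      apply: contraNneq xz => ef; rewrite -ef Ee in Ef.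
      have xy := adj_neq (edge_adj Ee).
      have /set2P[xy'|->] // : x \in [set y; z] by rewrite -Ef set21.
      by rewrite xy' eqxx in xy.
    by apply/pred0Pn; exists y; rewrite /= Ee Ef set22 set21.
  exists g; split => //.
  - by move=> x y _; rewrite /g setUC.
  - by move=> x y /adj_edge[e /gE->].
  move=> x0 x1 x2 x3 x4 a01 a12 a23 a34 n02 n13 n24.
  apply/negP=> /andP[/eqP E1 /eqP E2].
  have [e1 H1] := adj_edge a01; have [e2 H2] := adj_edge a12.
  have [e3 H3] := adj_edge a23; have [e4 H4] := adj_edge a34.
  (* If [x0 = x3], the first and third edges meet there and share a color, against properness;
     likewise for [x1 = x4]. *)
  have n03 : x0 != x3.
    apply/eqP=> E; subst x3.
    by have := gP _ _ _ a23 a01; rewrite eq_sym (adj_neq a12) E1 eqxx => /(_ isT).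
  have n14 : x1 != x4.
    apply/eqP=> E; subst x4.
    by have := gP _ _ _ a34 a12; rewrite eq_sym (adj_neq a23) E2 eqxx => /(_ isT).
  have tw : is_path4 [tuple e1; e2; e3; e4] || is_cycle4 [tuple e1; e2; e3; e4].
    case: (eqVneq x0 x4) => [E|n04].
      subst x4; apply/orP; right; apply/existsP; exists x0.
      apply/existsP; exists [tuple x1; x2; x3].
      rewrite /= H1 H2 H3 H4 eqxx andbT !inE !negb_or.
      by rewrite n02 n03 n13 !adj_neq.
    apply/orP; left; apply/existsP; exists x0.
    apply/existsP; exists [tuple x1; x2; x3; x4].
    rewrite /= H1 H2 H3 H4 eqxx andbT !inE !negb_or.
    by rewrite n02 n03 n04 n13 n14 n24 !adj_neq.
  have N := gP _ _ _ a01 a12 n02; have := implyP (sc _) tw.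
  move: E1 E2 N; rewrite (gE _ _ _ H1) (gE _ _ _ H2) (gE _ _ _ H3) (gE _ _ _ H4).
  move=> /val_inj E1 /val_inj E2; rewrite /bichromatic /= -E1 -E2 => N.
  by rewrite !inE !eqxx !orbT /= (inj_eq val_inj) in N *; rewrite (negPf N).
(* Symmetry of [g] makes the color of an edge independent of the order of its ends. *)
have [c cE] : exists c : edge G -> 'I_k,
    forall e x y, val e = [set x; y] -> g x y = c e.
  apply: (@fin_all_exists _ (fun=> 'I_k)
    (fun e i => forall x y, val e = [set x; y] -> g x y = i)) => e.
  have := valP e; rewrite inE => /existsP[u /existsP[v /andP[uv /eqP E]]].
  exists (Ordinal (gk _ _ uv)) => x y E'; have xy := edge_adj E'.
  have := esym E'; rewrite E => {}E'.
  have xNy := adj_neq xy; have uNv := adj_neq uv.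
  have /set2P[Ex|Ex] : x \in [set u; v] by rewrite -E' set21.
    have /set2P[Ey|->] : y \in [set u; v] by rewrite -E' set22.
      by rewrite Ex Ey eqxx in xNy.
    by rewrite Ex.
  have /set2P[->|Ey] : y \in [set u; v] by rewrite -E' set22.
    by rewrite Ex /= gS // adj_sym.
  by rewrite Ex Ey eqxx in xNy.
exists (finfun c); apply/andP; split.
  apply/'forall_forallP=> e f; apply/implyP=> /andP[ef /pred0Pn[z /andP[ze zf]]].
  have [x xz Ee] := edge_end ze; have [y yz Ef] := edge_end zf.
  rewrite !ffunE -val_eqE /= -(cE _ _ _ Ee); rewrite setUC in Ef.
  rewrite -(cE _ _ _ Ef); apply: gP => //; first by rewrite adj_sym.
  apply: contraNneq ef => xy; apply/eqP/val_inj.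
  by rewrite Ee Ef xy setUC.
apply/forallP=> t; apply/implyP=> tw.
have [x0 [x1 [x2 [x3 [x4 [n02 n13 n24 Et]]]]]] : exists x0 x1 x2 x3 x4,
    [/\ x0 != x2, x1 != x3, x2 != x4 & map val t = steps x0 [:: x1; x2; x3; x4]].
  case/orP: tw => /existsP[x /existsP[[s /= sz] /andP[Us /eqP->]]].
    case: s sz Us => [|x1 [|x2 [|x3 [|x4 []]]]] //= _.
    rewrite !inE !negb_or -!andbA => U; exists x, x1, x2, x3, x4.
    by case/and5P: U => _ -> _ _ /and5P[_ -> _ _ /and3P[-> _ _]].
  case: s sz Us => [|x1 [|x2 [|x3 []]]] //= _.
  rewrite !inE !negb_or -!andbA => U; exists x, x1, x2, x3, x.
  case/and5P: U => _ n _ _ /andP[-> _].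
  by rewrite eq_sym in n *; rewrite n.
rewrite /bichromatic.
case: (tval t) Et => [|e1 [|e2 [|e3 [|e4 []]]]] //= [] H1 H2 H3 H4.
have a01 := edge_adj H1; have a12 := edge_adj H2.
have a23 := edge_adj H3; have a34 := edge_adj H4.
have N1 := gP _ _ _ a01 a12 n02; have N2 := gP _ _ _ a12 a23 n13.
have N3 := gP _ _ _ a23 a34 n24.
have := g4 _ _ _ _ _ a01 a12 a23 a34 n02 n13 n24.
move: N1 N2 N3; rewrite (cE _ _ _ H1) (cE _ _ _ H2) (cE _ _ _ H3) (cE _ _ _ H4).
rewrite !(inj_eq val_inj) !ffunE !inE.
case: (eqVneq (c e1) (c e2)) => // N12 _; case: (eqVneq (c e2) (c e3)) => // _ _.
case: (eqVneq (c e3) (c e4)) => // _ _.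
(* If the first and third colors agree, then the second and fourth differ and colors 2, 3, 4 are
   distinct; otherwise colors 1, 2, 3 are distinct. *)
case: (eqVneq (c e1) (c e3)) => /= [_|_].
  by case: (eqVneq (c e2) (c e4)) => //= _; case: (c e3 == c e4).
case: (eqVneq (c e1) (c e4)) N12 => [->|_] /=; last by case: (c e2 == c e4).
by rewrite eq_sym => /negPf->.
Qed.

End EdgeWeights.

(** * Walks in prisms and ladders *)

(* A direction is [None] for the rung, [Some true] for the next column and
   [Some false] for the previous one.  An edge is a pair of a column and of
   [None] for the rung of that column, or [Some s] for the edge that joins, on
   side [s], that column to the next one. *)
Definition dir := option bool.

Definition opp_dir (d : dir) : dir := omap negb d.

(** The column type is a parameter: the same walks are read in the prism, with cyclic successor, and
    in the ladder over [nat]. *)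
Definition move (T : Type) (nx pv : T -> T) (d : dir) (v : T * bool) :=
  match d with
  | None => (v.1, ~~ v.2)
  | Some true => (nx v.1, v.2)
  | Some false => (pv v.1, v.2)
  end.

Definition edge_along (T : Type) (pv : T -> T) (d : dir) (v : T * bool) :
    T * option bool :=
  match d with
  | None => (v.1, None)
  | Some true => (v.1, Some v.2)
  | Some false => (pv v.1, Some v.2)
  end.

Fixpoint walk (T : Type) (nx pv : T -> T) (v : T * bool) (ds : seq dir) :=
  if ds is d :: ds' then
    edge_along pv d v :: walk nx pv (move nx pv d v) ds'
  else [::].

Definition nonbacktracking (ds : seq dir) : bool :=
  sorted (fun d d' => d' != opp_dir d) ds.

(* Vacuous on walks whose length is neither 2 nor 4. *)
Definition star_on (T : Type) (F : T -> nat) (q : seq T) : bool :=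
  match q with
  | [:: e1; e2] => F e1 != F e2
  | [:: e1; e2; e3; e4] => ~~ ((F e1 == F e3) && (F e2 == F e4))
  | _ => true
  end.

Lemma star_on_map (T U : Type) (h : T -> U) (F : U -> nat) (q : seq T) :
  star_on F (map h q) = star_on (F \o h) q.
Proof. by case: q => [|e1 [|e2 [|e3 [|e4 []]]]]. Qed.

Lemma eq_in_star_on (T : eqType) (F F' : T -> nat) (q : seq T) :
  {in q, F =1 F'} -> star_on F q = star_on F' q.
Proof.
case: q => [|e1 [|e2 [|e3 [|e4 []]]]] //= E; rewrite !E //;
  by rewrite !inE eqxx ?orbT.
Qed.

Section Prism.

Variable m : nat.
Hypothesis m_ge3 : 3 <= m.

Notation prism := (box_product (cycle_graph m) (path_graph 2)).
Notation pmove := (move (@ordS m) (@ord_pred m)).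
Notation pedge := (edge_along (@ord_pred m)).
Notation pwalk := (walk (@ordS m) (@ord_pred m)).

Definition prism_vertex (v : 'I_m * bool) : prism :=
  (v.1, if v.2 then ord_max else ord0).

Lemma prism_vertex_surj (x : prism) : exists v, x = prism_vertex v.
Proof.
case: x => i [[|[|//]] j_lt].
  by exists (i, false); congr pair; apply: val_inj.
by exists (i, true); congr pair; apply: val_inj.
Qed.

Lemma prism_vertex_inj : injective prism_vertex.
Proof. by move=> [i [] ] [j [] ] // [->]. Qed.

Lemma ordS_neq (i : 'I_m) : ordS i != i.
Proof.
rewrite -val_eqE /=; have := ltn_ord i.
case: (ltngtP i.+1 m) => [lt|//|E] _; first by rewrite modn_small // gtn_eqF.
by rewrite E modnn; apply/eqP=> i0; move: E m_ge3; rewrite -i0 => <-.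
Qed.

Lemma ordS_ord_pred_neq (i : 'I_m) : ordS i != ord_pred i.
Proof.
rewrite -(inj_eq (@ordS_inj m)) ord_predK -val_eqE /=; have := ltn_ord i.
have [lt _|ge lt] := ltnP i.+1 m.
  rewrite (modn_small lt); case: (ltngtP i.+2 m) lt => // [lt _|E _].
    by rewrite modn_small //; lia.
  by rewrite E modnn; lia.
have -> : i.+1 = m by lia.
by rewrite modnn modn_small; lia.
Qed.

Lemma pmoveK d : cancel (pmove d) (pmove (opp_dir d)).
Proof. by case: d => [[]|] [i s]; rewrite /= ?ordSK ?ord_predK ?negbK. Qed.

(** Since [m >= 3], the three neighbors of a vertex are distinct, so a step is determined by its end
    and backtracking can be tested on directions. *)
Lemma pmove_inj v : injective (fun d => pmove d v).
Proof.
have N1 i := negPf (ordS_neq i); have N2 i := negPf (ordS_ord_pred_neq i).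
have N3 (i : 'I_m) : ord_pred i == i = false.
  by rewrite -(inj_eq (@ordS_inj m)) ord_predK eq_sym N1.
case: v => i s [[]|] [[]|] //= /(congr1 fst) /= /eqP;
  by rewrite ?N1 ?N3 ?N2 // eq_sym ?N1 ?N3 ?N2.
Qed.

Lemma adj_pmove v d : adj (prism_vertex v) (prism_vertex (pmove d v)).
Proof.
case: v d => i s [[]|] /=; rewrite /box_adj /= /cycle_adj ?eqxx ?orbT ?andbT //=.
- by rewrite eq_sym ordS_neq.
- by rewrite ord_predK eqxx orbT andbT -{1}(ord_predK i) ordS_neq.
- by case: s.
Qed.

Lemma adj_prismP v (y : prism) :
  reflect (exists d, y = prism_vertex (pmove d v)) (adj (prism_vertex v) y).
Proof.
apply: (iffP idP) => [|[d ->]]; last exact: adj_pmove.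
have [[j t] ->] := prism_vertex_surj y; case: v => i s.
rewrite /= /box_adj /= => /orP[/andP[/andP[_ ij] st]|/andP[/eqP<- st]].
  have <- : s = t by case: s t st => [] [].
  case/orP: ij => /eqP->; first by exists (Some true).
  by exists (Some false); rewrite /= ordSK.
by exists None; congr prism_vertex; case: s t st => [] [].
Qed.

Lemma pmove_neq_back v d d' :
  (prism_vertex v != prism_vertex (pmove d' (pmove d v))) = (d' != opp_dir d).
Proof.
rewrite (inj_eq prism_vertex_inj) -{1}(pmoveK d v) eq_sym.
by rewrite (inj_eq (@pmove_inj _)).
Qed.

Lemma pedge_pmove v d : pedge (opp_dir d) (pmove d v) = pedge d v.
Proof. by case: v d => i s [[]|] //=; rewrite ordSK. Qed.

Lemma prism_star_edge_colorableP k :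
  reflect (exists F : 'I_m * option bool -> nat, (forall e, F e < k) /\
     forall v ds, nonbacktracking ds -> star_on F (pwalk v ds))
    (star_edge_colorable prism k).
Proof.
apply: (iffP (star_edge_colorableP _ _)) => [[g [gS gk gP g4]]|[F [Fk Fstar]]].
  (* Each edge is read in one fixed orientation; [FE] recovers the other by symmetry. *)
  pose F (e : 'I_m * option bool) :=
    if e.2 is Some s then g (prism_vertex (e.1, s)) (prism_vertex (ordS e.1, s))
    else g (prism_vertex (e.1, false)) (prism_vertex (e.1, true)).
  have FE d v : F (pedge d v) = g (prism_vertex v) (prism_vertex (pmove d v)).
    case: v d => i s [[]|] //=.
      by rewrite /F /= ord_predK gS // -{2}(ord_predK i) (adj_pmove (_, _) (Some true)).
    rewrite /F /=; case: s => //=.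
    by rewrite gS // (adj_pmove (i, false) None).
  exists F; split.
    case=> i [s|]; rewrite /F /=; apply: gk.
      exact: (adj_pmove (_, _) (Some true)).
    exact: (adj_pmove (i, false) None).
  move=> v [|d1 [|d2 [|d3 [|d4 []]]]] //=; rewrite !FE /nonbacktracking /= ?andbT.
    by move=> n12; apply: gP; rewrite ?adj_pmove ?pmove_neq_back.
  case/and3P=> n12 n23 n34.
  by apply: g4; rewrite ?adj_pmove ?pmove_neq_back.
(* By injectivity of [prism_vertex] and [pmove_inj] at most one pair is picked; non-adjacent pairs
   get 0. *)
pose g (x y : prism) : nat :=
  if [pick vd : ('I_m * bool) * dir |
        (x == prism_vertex vd.1) && (y == prism_vertex (pmove vd.2 vd.1))]
  is Some vd then F (pedge vd.2 vd.1) else 0.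
have gE v d : g (prism_vertex v) (prism_vertex (pmove d v)) = F (pedge d v).
  rewrite /g; case: pickP => [[u d'] /= /andP[]|/(_ (v, d))]; last by rewrite /= !eqxx.
  move=> /eqP/prism_vertex_inj <- /eqP/prism_vertex_inj.
  by move/(@pmove_inj v)=> ->.
exists g; split.
- move=> x y; have [v ->] := prism_vertex_surj x.
  case/adj_prismP=> d ->; rewrite gE.
  by have := gE (pmove d v) (opp_dir d); rewrite pmoveK pedge_pmove.
- move=> x y; have [v ->] := prism_vertex_surj x.
  by case/adj_prismP=> d ->; rewrite gE.
- move=> x y z; have [v ->] := prism_vertex_surj x.
  case/adj_prismP=> d1 -> /adj_prismP[d2 ->]; rewrite pmove_neq_back !gE => n12.
  by apply: (Fstar v [:: d1; d2]); rewrite /nonbacktracking /= n12.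
move=> x0 x1 x2 x3 x4; have [v ->] := prism_vertex_surj x0.
case/adj_prismP=> d1 -> /adj_prismP[d2 ->] /adj_prismP[d3 ->] /adj_prismP[d4 ->].
rewrite !pmove_neq_back !gE => n12 n23 n34.
by apply: (Fstar v [:: d1; d2; d3; d4]); rewrite /nonbacktracking /= n12 n23 n34.
Qed.

End Prism.

(** * Lifting walks to the ladder; windows of four columns *)

Notation lwalk := (walk S predn).

(* Excludes the moves to the left of column 0, where [predn] is stuck. *)
Fixpoint in_ladder (v : nat * bool) (ds : seq dir) : bool :=
  if ds is d :: ds' then
    ((d == Some false) ==> (0 < v.1)) && in_ladder (move S predn d v) ds'
  else true.

Fixpoint dirseqs (n : nat) : seq (seq dir) :=
  if n is n'.+1 then
    [seq d :: ds | d <- [:: None; Some false; Some true], ds <- dirseqs n']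
  else [:: [::]].

(** Starting vertices range up to column [n] itself, which holds the right ends of the last
    horizontal edges. *)
Definition ladder_walks (n : nat) : seq (seq (nat * option bool)) :=
  [seq q <-
     [seq lwalk x.1 x.2 |
       x <- [seq x <-
              [seq (v, ds) |
                v <- [seq (i, s) | i <- iota 0 n.+1, s <- [:: false; true]],
                ds <- dirseqs 2 ++ dirseqs 4] |
              nonbacktracking x.2 && in_ladder x.1 x.2]] |
     all (fun e => e.1 < n) q].

Lemma mem_dirseqs ds : ds \in dirseqs (size ds).
Proof.
elim: ds => [|d ds IH] //.
by apply: (allpairs_f cons) => //; case: d => [[]|].
Qed.

Lemma ladder_walksP n q : q \in ladder_walks n ->
  exists v ds, [/\ nonbacktracking ds, in_ladder v ds, q = lwalk v ds
                 & all (fun e => e.1 < n) q].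
Proof.
rewrite mem_filter => /andP[qn /mapP[[v ds]]].
by rewrite mem_filter => /andP[/andP[nb lad] _] /= E; exists v, ds.
Qed.

(* No walk with at most four edges meets more than four columns of edges. *)
Lemma ladder_walk_window s ds : nonbacktracking ds ->
    (size ds == 2) || (size ds == 4) ->
  in_ladder (4, s) ds /\ exists i, exists2 q, q \in ladder_walks 4
    & lwalk (4, s) ds = [seq (e.1 + i, e.2) | e <- q].
Proof.
(* Column 4 leaves room for four moves to the left. The filter on [i] keeps the truncated
   subtraction exact, so adding [i] undoes it. *)
pose P s ds := nonbacktracking ds ==> in_ladder (4, s) ds &&
  has (fun i => [seq (e.1 - i, e.2) | e <- lwalk (4, s) ds] \in ladder_walks 4)
    [seq i <- iota 0 8 | all (fun e => i <= e.1) (lwalk (4, s) ds)].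
have H : all (fun s => all (P s) (dirseqs 2 ++ dirseqs 4)) [:: false; true].
  by vm_compute.
move=> nb sz; have ds_in : ds \in dirseqs 2 ++ dirseqs 4.
  have := mem_dirseqs ds; rewrite mem_cat.
  by case/orP: sz => /eqP-> ->; rewrite ?orbT.
have s_in : s \in [:: false; true] by case: s.
have := allP (allP H s s_in) ds ds_in.
rewrite /P nb implyTb => /andP[-> /hasP[i]]; rewrite mem_filter => /andP[/allP le_i _] q_in.
split=> //; exists i, [seq (e.1 - i, e.2) | e <- lwalk (4, s) ds] => //.
rewrite -map_comp -[LHS]map_id; apply/eq_in_map => -[j t] /le_i /= ij.
by rewrite subnK.
Qed.

(** A map commuting with successors also commutes with predecessors away from column 0, which
    [in_ladder] ensures. *)
Lemma map_lwalk m (p : nat -> 'I_m) v ds :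
    (forall i, p i.+1 = ordS (p i)) -> in_ladder v ds ->
  [seq (p e.1, e.2) | e <- lwalk v ds]
    = walk (@ordS m) (@ord_pred m) (p v.1, v.2) ds.
Proof.
move=> pS; elim: ds v => //= d ds IH [i s] /andP[lad /IH->].
case: d lad => [[]|] //= i_gt0; first by rewrite pS.
suff -> : ord_pred (p i) = p i.-1 by [].
by rewrite -{1}(prednK i_gt0) pS ordSK.
Qed.

Lemma val_iter_ordS m i (j : 'I_m) : val (iter i (@ordS m) j) = (j + i) %% m.
Proof.
elim: i => [|i IH] /=; first by rewrite addn0 modn_small.
by rewrite IH addnS -[in LHS]addn1 modnDml addn1.
Qed.

Lemma prism_star_of_windows m (F : 'I_m * option bool -> nat) :
    (forall j, all (star_on (fun e => F (iter e.1 (@ordS m) j, e.2)))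
                 (ladder_walks 4)) ->
  forall v ds, nonbacktracking ds ->
    star_on F (walk (@ordS m) (@ord_pred m) v ds).
Proof.
move=> win [i s] ds nb.
have [sz|sz] := boolP ((size ds == 2) || (size ds == 4)); last first.
  by case: ds sz {nb} => [|d1 [|d2 [|d3 [|d4 []]]]].
have [lad [k [q q_in E]]] := ladder_walk_window s nb sz.
(* Going back four columns makes ladder column 4 lie over column [i]. *)
pose j := iter 4 (@ord_pred m) i; pose p n := iter n (@ordS m) j.
have pi4 : p 4 = i by rewrite /p /j /= !ord_predK.
rewrite -pi4 -(@map_lwalk m p (4, s) ds (fun=> erefl) lad).
rewrite E -map_comp star_on_map.
have := allP (win (p k)) _ q_in; congr (is_true _); apply: eq_in_star_on.
by case=> n t _ /=; rewrite /p iterD.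
Qed.

(** Pull the coloring back along the covering of the prism by the ladder. *)
Lemma prism_ladder_coloring m k : 3 <= m ->
    star_edge_colorable (box_product (cycle_graph m) (path_graph 2)) k ->
  exists F : nat * option bool -> nat,
    [/\ forall e, F e < k, forall i t, F (i + m, t) = F (i, t)
      & forall i n, all (star_on (fun e => F (i + e.1, e.2))) (ladder_walks n)].
Proof.
move=> m_ge3 /(prism_star_edge_colorableP m_ge3)[F [Fk Fstar]].
have m_gt0 : 0 < m by apply: leq_trans m_ge3.
pose p i := iter i (@ordS m) (Ordinal m_gt0).
exists (fun e => F (p e.1, e.2)); split=> // [i t|i n].
  by congr (F (_, _)); apply: val_inj; rewrite !val_iter_ordS /= !add0n modnDr.
apply/allP=> q /ladder_walksP[v [ds [nb lad -> _]]].
have := @map_lwalk m (fun j => p (i + j)) _ _ _ lad.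
rewrite -(star_on_map (fun e => (p (i + e.1), e.2)) F) => ->; first exact: Fstar.
by move=> j; rewrite addnS.
Qed.

(** * Upper bounds *)

(** Colors of the rung, then of the edges to the next column on sides [false] and [true]. *)
Notation column := (nat * nat * nat)%type.

Definition column_color (c : column) (t : option bool) : nat :=
  match t with None => c.1.1 | Some false => c.1.2 | Some true => c.2 end.

Definition color_of (w : seq column) (e : nat * option bool) : nat :=
  column_color (nth (0, 0, 0) w e.1) e.2.

Definition windows_ok (w : seq column) : bool :=
  all (fun i => all (star_on (color_of (drop i w))) (ladder_walks 4))
    (iota 0 (size w - 3)).

Lemma eq_star_windows (F F' : nat * option bool -> nat) :
    (forall i t, i < 4 -> F (i, t) = F' (i, t)) ->
  all (star_on F) (ladder_walks 4) = all (star_on F') (ladder_walks 4).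
Proof.
move=> FF'; apply: eq_in_all => q /ladder_walksP[_ [_ [_ _ _ /allP q4]]].
by apply: eq_in_star_on => -[i t] /q4; apply: FF'.
Qed.

(** A four-column window starting in [b] ends within [b ++ p], because [p] has three columns; any
    other lies in [p ++ w]. *)
Lemma windows_ok_cat (b p w : seq column) : size p = 3 ->
  windows_ok (b ++ p) -> windows_ok (p ++ w) -> windows_ok (b ++ p ++ w).
Proof.
move=> p3 /allP okb /allP okw; apply/allP=> i.
rewrite mem_iota add0n !size_cat /= => i_lt.
have [ib|bi] := ltnP i (size b).
  have := okb i; rewrite mem_iota size_cat p3 addnK ib => /(_ isT).
  congr (is_true _); apply: eq_star_windows => j t j4; rewrite /color_of /=.
  congr column_color; rewrite !nth_drop catA [RHS]nth_cat ifT // size_cat; lia.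
rewrite drop_cat ltnNge bi /=; apply: okw.
rewrite mem_iota size_cat; lia.
Qed.

(** Repeating the first three columns at the end turns the windows that wrap around the cycle into
    ordinary ones. *)
Lemma prism_colorable_of_columns k (p w : seq column) : size p = 3 ->
    windows_ok (p ++ w ++ p) ->
    all (fun c => [&& c.1.1 < k, c.1.2 < k & c.2 < k]) (p ++ w) ->
  star_edge_colorable
    (box_product (cycle_graph (size (p ++ w))) (path_graph 2)) k.
Proof.
move=> p3; set s := p ++ w; set m := size s; rewrite catA -/s => ok lt_k.
have sE : m = size w + 3 by rewrite /m size_cat p3 addnC.
apply/prism_star_edge_colorableP; first by lia.
exists (fun e => color_of s (val e.1, e.2)); split.
  case=> i t; have := all_nthP (0, 0, 0) lt_k i (ltn_ord i).
  by rewrite /color_of /column_color => /and3P[? ? ?]; case: t => [[]|].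
apply: prism_star_of_windows => j.
have := allP ok j; rewrite mem_iota size_cat p3 addnK ltn_ord => /(_ isT).
congr (is_true _); apply: eq_star_windows => i t i4; have := ltn_ord j.
rewrite /color_of -/m => jm; congr column_color.
rewrite /= -/m val_iter_ordS nth_drop nth_cat -/m; case: ltnP => [lt|ge].
  by rewrite modn_small.
have -> : (j + i) %% m = j + i - m.
  by rewrite -{1}(subnK ge) modnDr modn_small; lia.
by rewrite nth_cat ifT //; lia.
Qed.

Lemma prism_colorable_blocks k (p b w : seq column) a : size p = 3 ->
    windows_ok (p ++ b ++ p) -> windows_ok (p ++ w ++ p) ->
    all (fun c => [&& c.1.1 < k, c.1.2 < k & c.2 < k]) (p ++ b ++ w) ->
  star_edge_colorable
    (box_product (cycle_graph (a * size (p ++ b) + size (p ++ w)))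
       (path_graph 2)) k.
Proof.
move=> p3 okb okw; rewrite !all_cat => /and3P[pk bk wk].
have [s [sE sok sk]] : exists s,
    [/\ size (p ++ s) = a * size (p ++ b) + size (p ++ w),
        windows_ok (p ++ s ++ p)
      & all (fun c => [&& c.1.1 < k, c.1.2 < k & c.2 < k]) s].
  (* Each step prepends a copy of [p ++ b], glued along the [p] that follows it. *)
  elim: a => [|a [s [IH sok sk]]]; first by exists w.
  exists (b ++ p ++ s); split; last by rewrite !all_cat bk pk.
    by rewrite mulSn -addnA -IH catA size_cat.
  have := @windows_ok_cat (p ++ b) p (s ++ p) p3.
  by rewrite -!catA; apply.
by rewrite -sE; apply: prism_colorable_of_columns => //; rewrite all_cat pk.
Qed.

Lemma star_edge_colorable_prism3 :
  star_edge_colorable (box_product (cycle_graph 3) (path_graph 2)) 6.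
Proof.
apply: (@prism_colorable_of_columns 6 [:: (0,1,1); (2,3,3); (0,4,5)] [::]);
  by vm_compute.
Qed.

Lemma star_edge_colorable_prism_mod4 m : 0 < m -> m %% 4 = 0 ->
  star_edge_colorable (box_product (cycle_graph m) (path_graph 2)) 4.
Proof.
move=> m_gt0 m4; have -> : m = (m %/ 4).-1 * 4 + 4 by lia.
(* Each column is the previous one decreased by 1 modulo 4, a pattern of period 4. *)
apply: (@prism_colorable_blocks 4 [:: (0,1,2); (3,0,1); (2,3,0)]
  [:: (1,2,3)] [:: (1,2,3)]); by vm_compute.
Qed.

Lemma star_edge_colorable_prism m : 4 <= m ->
  star_edge_colorable (box_product (cycle_graph m) (path_graph 2)) 5.
Proof.
(* The repeated block has four columns; a final block of 4, 5, 6 or 7 columns fixes the residue of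
   [m]. *)
move=> m_ge4; have := prism_colorable_blocks (k := 5)
  (p := [:: (0,1,1); (2,3,3); (0,4,4)]) (b := [:: (2,3,3)]).
move=> blocks; have := ltn_mod m 4; case E: (m %% 4) => [|[|[|[|//]]]] _.
- have -> : m = (m %/ 4).-1 * 4 + 4 by lia.
  by apply: (blocks [:: (2,3,3)]); vm_compute.
- have -> : m = (m %/ 4).-1 * 4 + 5 by lia.
  by apply: (blocks [:: (1,2,2); (0,3,4)]); vm_compute.
- have -> : m = (m %/ 4).-1 * 4 + 6 by lia.
  by apply: (blocks [:: (1,2,3); (0,1,2); (3,4,4)]); vm_compute.
have -> : m = (m %/ 4).-1 * 4 + 7 by lia.
by apply: (blocks [:: (1,2,2); (0,3,3); (1,4,4); (2,3,3)]); vm_compute.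
Qed.

(** * Lower bounds *)

(** Search with pruning: once edge [n'] is colored, only the walks having it as largest edge are
    tested. *)
Fixpoint star_colorings (k : nat) (qs : seq (seq nat)) (n : nat) : seq (seq nat) :=
  if n is n'.+1 then
    let qn := [seq q <- qs | (n' \in q) && all (fun e => e < n) q] in
    [seq w <- [seq rcons w x | w <- star_colorings k qs n', x <- iota 0 k] |
       all (star_on (nth 0 w)) qn]
  else [:: [::]].

(** Completeness of the search: an empty result rules out every coloring. *)
Lemma mem_star_colorings k qs (F : nat -> nat) n :
    (forall e, F e < k) -> all (star_on F) qs ->
  mkseq F n \in star_colorings k qs n.
Proof.
move=> Fk /allP Fqs; elim: n => [|n IH] //.
rewrite [star_colorings _ _ _]/= mem_filter; apply/andP; split.
  apply/allP=> q; rewrite mem_filter => /andP[/andP[_ /allP qn] /Fqs].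
  congr (is_true _); apply: eq_in_star_on => e /qn e_lt.
  by rewrite nth_mkseq.
rewrite mkseqS; apply: (allpairs_f rcons) => //.
by rewrite mem_iota /= Fk.
Qed.

(** Edges are numbered column by column, so the first [3 * n] codes are exactly the first [n]
    columns. *)
Definition edge_code (e : nat * option bool) : nat :=
  3 * e.1 + match e.2 with None => 0 | Some s => s.+1 end.

Definition edge_decode (n : nat) : nat * option bool :=
  (n %/ 3, match n %% 3 with 0 => None | 1 => Some false | _ => Some true end).

Lemma edge_codeK : cancel edge_code edge_decode.
Proof.
case=> i t; rewrite /edge_code /edge_decode /= mulnC divnMDl // modnMDl.
by case: t => [[]|]; rewrite addn0.
Qed.

Definition ladder_codes (n : nat) : seq (seq nat) :=
  [seq map edge_code q | q <- ladder_walks n].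

Lemma ladder_coloring_window k n (F : nat * option bool -> nat) N :
    (forall e, F e < k) ->
    all (star_on F) (ladder_walks n) ->
  mkseq (F \o edge_decode) N \in star_colorings k (ladder_codes n) N.
Proof.
move=> Fk Fstar; apply: mem_star_colorings => [e|]; first exact: Fk.
rewrite all_map; apply: sub_all Fstar => q; rewrite /= star_on_map.
by congr (is_true _); apply: eq_in_star_on => e _; rewrite /= edge_codeK.
Qed.

Lemma prism_not_3_star_colorable m : 3 <= m ->
  ~~ star_edge_colorable (box_product (cycle_graph m) (path_graph 2)) 3.
Proof.
move=> m_ge3; apply/negP=> /(prism_ladder_coloring m_ge3)[F [Fk _ Fstar]].
have F0k e : F (0 + e.1, e.2) < 3 by [].
have := ladder_coloring_window 6 F0k (Fstar 0 2).
by have -> : star_colorings 3 (ladder_codes 2) 6 = [::] by vm_compute.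
Qed.

(** Positions 0 to 2, 6 to 8 and 12 to 14 hold the first, third and fifth columns. *)
Lemma star_colorings4_window :
  all (fun w => (drop 12 w == take 3 w) && (take 3 (drop 6 w) != take 3 w))
    (star_colorings 4 (ladder_codes 5) 15).
Proof. by vm_compute. Qed.

Lemma prism_4_star_colorable_mod4 m : 3 <= m ->
    star_edge_colorable (box_product (cycle_graph m) (path_graph 2)) 4 ->
  m %% 4 = 0.
Proof.
move=> m_ge3 /(prism_ladder_coloring m_ge3)[F [Fk Fm Fstar]].
pose C i := [:: F (i, None); F (i, Some false); F (i, Some true)].
have CE i : C (i + 4) = C i /\ C (i + 2) <> C i.
  have Fik e : F (i + e.1, e.2) < 4 by [].
  have := allP star_colorings4_window _ (ladder_coloring_window 15 Fik (Fstar i 5)).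
  by rewrite /C /= !addn0 => /andP[/eqP-> /eqP].
have C4 j i : C (i + j * 4) = C i.
  elim: j => [|j IH]; first by rewrite addn0.
  by rewrite mulSn [4 + _]addnC addnA (CE _).1.
have Cm j i : C (i + j * m) = C i.
  elim: j => [|j IH]; first by rewrite addn0.
  by rewrite -IH mulSn [m + _]addnC addnA /C !Fm.
apply/eqP/contraT => m4; case: (CE 0) => _ [].
(* If 4 does not divide [m], then [m] or [2 * m] is 2 modulo 4, so the periods 4 and [m] would force
   column 2 to equal column 0. *)
have [j [l E]] : exists j l, j * m = 2 + l * 4.
  have := ltn_mod m 4; case E: (m %% 4) m4 => [|[|[|[|//]]]] // _ _.
  - by exists 2, (m %/ 4 * 2); lia.
  - by exists 1, (m %/ 4); lia.
  by exists 2, (m %/ 4 * 2).+1; lia.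
by rewrite -(C4 l) add0n -E -[j * m]add0n Cm.
Qed.

Lemma prism3_not_5_star_colorable :
  ~~ star_edge_colorable (box_product (cycle_graph 3) (path_graph 2)) 5.
Proof.
apply/negP=> /(@prism_ladder_coloring 3 5 isT)[F [Fk F3 Fstar]].
(* Six columns contain a four-column window from each of the three starting columns; reducing modulo
   3 folds their walks onto the nine edges of the prism. *)
pose qs := [seq [seq edge_code (e.1 %% 3, e.2) | e <- q] | q <- ladder_walks 6].
have : mkseq (F \o edge_decode) 9 \in star_colorings 5 qs 9.
  apply: mem_star_colorings => [e|]; first exact: Fk.
  rewrite all_map; apply: sub_all (Fstar 0 6) => q; rewrite /= star_on_map.
  congr (is_true _); apply: eq_in_star_on => -[i t] _; rewrite /= edge_codeK add0n.
  rewrite {1}(divn_eq i 3) addnC; elim: (i %/ 3) => [|j IH]; first by rewrite addn0.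
  by rewrite mulSn [3 + _]addnC addnA F3.
by have -> : star_colorings 5 qs 9 = [::] by vm_compute.
Qed.

(** * Monotonicity in the number of colors, and the index *)

Lemma star_edge_colorableW (G : sgraph) k l : k <= l ->
  star_edge_colorable G k -> star_edge_colorable G l.
Proof.
move=> kl /star_edge_colorableP[g [gS gk gP g4]]; apply/star_edge_colorableP.
by exists g; split=> // x y /gk/leq_trans->.
Qed.

Lemma star_chromatic_index_eq (G : sgraph) k :
    star_edge_colorable G k.+1 -> ~~ star_edge_colorable G k ->
  star_chromatic_index G = k.+1.
Proof.
move=> ck nck; rewrite /star_chromatic_index; case: ex_minnP => n cn nmin.
apply/eqP; rewrite eqn_leq nmin //= ltnNge; apply: contra nck => nk.
exact: star_edge_colorableW cn.
Qed.

Theorem theorem25 (m : nat) (hm : 3 <= m) :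
  star_chromatic_index (box_product (cycle_graph m) (path_graph 2)) =
    if m == 3 then 6 else if m == 0 %[mod 4] then 4 else 5.
Proof.
have [->|m_neq3] := eqVneq m 3.
  apply: star_chromatic_index_eq; first exact: star_edge_colorable_prism3.
  exact: prism3_not_5_star_colorable.
have m_ge4 : 4 <= m by lia.
rewrite mod0n; have [m4|m4] := eqVneq (m %% 4) 0; apply: star_chromatic_index_eq.
- by apply: star_edge_colorable_prism_mod4 => //; lia.
- exact: prism_not_3_star_colorable.
- exact: star_edge_colorable_prism.
by apply: contra m4 => /(prism_4_star_colorable_mod4 hm)/eqP.
Qed.
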